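(* Let $S$ be a finite Kleene relation algebra satisfying the Tarski rule, let $p_0 \in S$ be a forest and let $x \in S$ be a point. Consider the program with program variables $p, y$ ranging over $S$, started with $p = p_0$: $y := x$; while $y \neq p^T\cdot y$ do $p := \big(y \sqcap (p^T\cdot p^T\cdot y)^T\big)\sqcup(\overline{y}\sqcap p)$; $y := p^T\cdot y$ od. Then the program terminates, and in its final state: $p$ is a forest; $y$ is a point; $y = ((p^T)^*\cdot x)\sqcap((p\sqcap 1)\cdot\top)$; $p^*\cdot(p^T)^* = p_0^*\cdot(p_0^T)^*$; $p\sqcap 1 = p_0\sqcap 1$; and $p = (v \sqcap (p_0\cdot p_0)) \sqcup (\overline{v}\sqcap p_0)$ where $v = ((p_0\cdot p_0)^T)^*\cdot x$.
   Context: A Kleene relation algebra is a structure $(S,\sqcup,\sqcap,\cdot,\overline{\phantom{x}},{}^T,{}^*,\bot,\top,1)$ such that $(S,\sqcup,\sqcap,\overline{\phantom{x}},\bot,\top)$ is a Boolean algebra with order $x \sqsubseteq y \iff x \sqcup y = y$; $(S,\sqcup,\cdot,\bot,1)$ is an idempotent semiring ($\cdot$ associative with two-sided unit $1$, distributing over $\sqcup$, $\bot$ a two-sided zero of $\cdot$); transposition satisfies $(x\sqcup y)^T = x^T \sqcup y^T$, $(x^T)^T = x$, $(x\cdot y)^T = y^T\cdot x^T$ and $(x\cdot y)\sqcap z \sqsubseteq x\cdot(y\sqcap(x^T\cdot z))$; and the star satisfies $1\sqcup y\cdot y^* = y^* = 1 \sqcup y^*\cdot y$, $z\sqcup y\cdot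 x\sqsubseteq x \Rightarrow y^*\cdot z\sqsubseteq x$, $z \sqcup x\cdot y \sqsubseteq x \Rightarrow z\cdot y^*\sqsubseteq x$. The Tarski rule states $\top\cdot x\cdot\top = \top$ for every $x \neq \bot$. Write $x^+ = x\cdot x^*$. An element $x$ is univalent if $x^T x\sqsubseteq 1$, total if $1\sqsubseteq x x^T$, a mapping if univalent and total, injective if $x x^T\sqsubseteq 1$, surjective if $1\sqsubseteq x^T x$, a vector if $x\cdot\top = x$, a point if it is an injective surjective vector, acyclic if $x^+\sqsubseteq\overline 1$, and a forest if it is a mapping and $x\sqcap\overline{1}$ is acyclic. Programs are sequential while-programs with the usual semantics; $p^T\cdot y$ reads the parent of node $y$ in the current $p$ (so the second loop assignment uses the updated $p$). The final equation says $p$ is the array update of $p_0$ at all nodes in $v$ (nodes reachable from $x$ in an even number of parent steps) to the value $(p_0\cdot p_0)^T$. *)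

(* Defs.v *)
From HB Require Import structures.
From mathcomp Require Import all_boot all_order.

Set Implicit Arguments.
Unset Strict Implicit.
Unset Printing Implicit Defensive.

Import Order.Theory.
Local Open Scope order_scope.

Reserved Notation "x ^T" (format "x ^T").

Declare Scope kra_scope.
Delimit Scope kra_scope with KRA.

(* Only the operations beyond the Boolean algebra are fields. The additive    *)
(* part of the idempotent semiring is the join, with neutral element \bot; it *)
(* comes with the lattice structure, as does x <= y <-> x `|` y = y.          *)
HB.mixin Record isKleeneRelationAlgebra (d : Order.disp_t) S
    of Order.CTBDistrLattice d S := {
  comp : S -> S -> S;
  id1 : S;
  conv : S -> S;
  star : S -> S;
  compA : forall x y z : S, comp x (comp y z) = comp (comp x y) z;
  comp1x : forall x : S, comp id1 x = x;
  compx1 : forall x : S, comp x id1 = x;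
  compUl : forall x y z : S, comp (x `|` y) z = comp x z `|` comp y z;
  compUr : forall x y z : S, comp x (y `|` z) = comp x y `|` comp x z;
  comp0x : forall x : S, comp \bot x = \bot;
  compx0 : forall x : S, comp x \bot = \bot;
  convU : forall x y : S, conv (x `|` y) = conv x `|` conv y;
  convK : forall x : S, conv (conv x) = x;
  conv_comp : forall x y : S, conv (comp x y) = comp (conv y) (conv x);
  dedekind : forall x y z : S,
    comp x y `&` z <= comp x (y `&` comp (conv x) z);
  star_unfoldl : forall y : S, id1 `|` comp y (star y) = star y;
  star_unfoldr : forall y : S, id1 `|` comp (star y) y = star y;
  star_inductl : forall x y z : S,
    z `|` comp y x <= x -> comp (star y) z <= x;
  star_inductr : forall x y z : S,
    z `|` comp x y <= x -> comp z (star y) <= x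
}.

#[short(type="kraType")]
HB.structure Definition KleeneRelationAlgebra (d : Order.disp_t) :=
  { S of Order.CTBDistrLattice d S & isKleeneRelationAlgebra d S }.

#[short(type="finKraType")]
HB.structure Definition FinKleeneRelationAlgebra (d : Order.disp_t) :=
  { S of KleeneRelationAlgebra d S & Finite S }.

Notation "x * y" := (comp x y) : kra_scope.
Notation "1" := id1 : kra_scope.
Notation "x ^T" := (conv x) : kra_scope.
Notation "x ^*" := (star x) : kra_scope.

Local Open Scope kra_scope.

Section Elements.
Context {d : Order.disp_t} {S : kraType d}.
Implicit Type x : S.

Definition star_plus x : S := x * x^*.

Definition univalent x : bool := x^T * x <= 1.
Definition total x : bool := 1 <= x * x^T.
Definition mapping x : bool := univalent x && total x.
Definition injective_elt x : bool := x * x^T <= 1.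
Definition surjective_elt x : bool := 1 <= x^T * x.
Definition is_vector x : bool := x * \top == x.
Definition point x : bool :=
  [&& injective_elt x, surjective_elt x & is_vector x].
Definition acyclic x : bool := star_plus x <= ~` 1.
Definition forest x : bool := mapping x && acyclic (x `&` ~` 1).

End Elements.

Definition tarski_rule {d : Order.disp_t} (S : kraType d) : Prop :=
  forall x : S, x != \bot -> \top * x * \top = \top.

Section WhilePrograms.
Variable State : Type.

Inductive cmd : Type :=
| Assign of (State -> State)
| Seq of cmd & cmd
| While of pred State & cmd.

(* Big-step semantics: since cmd is deterministic, a program terminates from  *)
(* s exactly when exec c s t holds for some t.                                *)
Inductive exec : cmd -> State -> State -> Prop :=
| ExecAssign f s : exec (Assign f) s (f s)
| ExecSeq c1 c2 s t u : exec c1 s t -> exec c2 t u -> exec (Seq c1 c2) s u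
| ExecWhileFalse b c s : b s = false -> exec (While b c) s s
| ExecWhileTrue b c s t u :
    b s = true -> exec c s t -> exec (While b c) t u -> exec (While b c) s u.

Definition terminates (c : cmd) (s : State) : Prop := exists t, exec c s t.

End WhilePrograms.

Section PathHalving.
Context {d : Order.disp_t} {S : finKraType d}.

Record store : Type := Store { pvar : S; yvar : S }.

Definition assign_p (e : S -> S -> S) : cmd store :=
  Assign (fun s => Store (e (pvar s) (yvar s)) (yvar s)).
Definition assign_y (e : S -> S -> S) : cmd store :=
  Assign (fun s => Store (pvar s) (e (pvar s) (yvar s))).
Definition while_do (b : S -> S -> bool) (c : cmd store) : cmd store :=
  While (fun s => b (pvar s) (yvar s)) c.

Definition path_halving (x : S) : cmd store :=
  Seq (assign_y (fun p y => x))
      (while_do (fun p y => y != p^T * y)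
        (Seq (assign_p (fun p y =>
                (y `&` (p^T * p^T * y)^T) `|` (~` y `&` p)))
             (assign_y (fun p y => p^T * y)))).

End PathHalving.

(* Main.v *)
Require Import Defs.
From HB Require Import structures.
From mathcomp Require Import all_boot all_order.

Set Implicit Arguments.
Unset Strict Implicit.
Unset Printing Implicit Defensive.

Import Order.Theory.
Local Open Scope order_scope.
Local Open Scope kra_scope.

(** The k-th ancestor a_k of x under p0 is a point, and by the Tarski rule two
    points are equal or disjoint. If a_i = a_j with i < j then acyclicity
    forces a_i to be a root; as S is finite, there is a least n such that
    a_(2n) is a root. After k <= n iterations y = a_(2k), and p is p0
    redirected to p0 * p0 at a_0, a_2, .., a_(2k-2): the nodes a_(2k) and
    a_(2k+1) read by the next iteration have not been redirected yet. The
    semantics is deterministic, so the final state is this one for k = n,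
    where v is the join of a_0, a_2, .., a_(2n). All ancestors of x still lead
    to a_(2n) in the final p, hence the components are unchanged. *)

(* ssrfun and ssrbool export other constants under these two names. *)
Local Notation compA := Defs.compA.
Local Notation total := Defs.total.

(** * Order, converse and subidentities *)

Section RelationAlgebra.
Context {d : Order.disp_t} {S : kraType d}.
Implicit Types a b c e f g p q v x y z : S.

Lemma leIC_leU x y z : x `&` ~` y <= z -> x <= y `|` z.
Proof. by rewrite -diffE leBLR. Qed.

Lemma comp_le x y z t : x <= y -> z <= t -> x * z <= y * t.
Proof.
move=> /join_idPr xy /join_idPr zt.
by rewrite -xy -zt compUl !compUr -joinA leUl.
Qed.

Lemma comp_lel x y z : x <= y -> x * z <= y * z.
Proof. by move=> xy; apply: comp_le. Qed.

Lemma comp_ler x y z : x <= y -> z * x <= z * y.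
Proof. by move=> xy; apply: comp_le. Qed.

Lemma conv_le x y : x <= y -> x^T <= y^T.
Proof. by move=> /join_idPl <-; rewrite convU leUr. Qed.

Lemma conv_leE x y : (x^T <= y) = (x <= y^T).
Proof. by apply/idP/idP => /conv_le; rewrite convK. Qed.

Lemma convI x y : (x `&` y)^T = x^T `&` y^T.
Proof.
apply/eqP; rewrite eq_le lexI !conv_le ?leIl ?leIr //= -conv_leE.
by rewrite lexI !conv_leE leIl leIr.
Qed.

Lemma conv1 : 1^T = 1 :> S.
Proof. by rewrite -[RHS]convK -[in RHS](comp1x 1^T) conv_comp convK comp1x. Qed.

Lemma convT : \top^T = \top :> S.
Proof. by apply: le_anti; rewrite lex1 /= -conv_leE lex1. Qed.

Lemma conv0 : \bot^T = \bot :> S.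
Proof. by apply: le_anti; rewrite le0x conv_leE le0x. Qed.

Lemma dedekindr x y z : x * y `&` z <= (x `&` z * y^T) * y.
Proof.
rewrite -[leLHS]convK conv_leE convI !conv_comp convI conv_comp convK.
by apply: le_trans (dedekind _ _ _) _; rewrite convK.
Qed.

Lemma comp_conv_comp x : x <= x * x^T * x.
Proof.
have := dedekind x 1 x; rewrite compx1 meetxx -compA => /le_trans; apply.
by apply/comp_ler/leIr.
Qed.

(** In [f <= f * f^T * f] both outer factors are at most [1], which leaves [f <= f^T]. *)
Lemma conv_subid e : e <= 1 -> e^T = e.
Proof.
have sub f : f <= 1 -> f <= f^T.
  move=> f1; apply: le_trans (comp_conv_comp f) _.
  apply: le_trans (comp_ler _ f1) _; rewrite compx1.
  by apply: le_trans (comp_lel _ f1) _; rewrite comp1x.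
by move=> e1; apply/eqP; rewrite eq_le sub // conv_leE sub.
Qed.

Lemma subid_idem e : e <= 1 -> e * e = e.
Proof.
move=> e1; apply/eqP; rewrite eq_le -[X in _ <= X]comp1x comp_lel //=.
apply: le_trans (comp_conv_comp e) _; rewrite conv_subid //.
by rewrite -[X in _ <= X * _]compx1 comp_lel // comp_ler.
Qed.

(** * Vectors as sets of nodes *)

Lemma vector_compT v : is_vector v -> v * \top = v.
Proof. by move=> /eqP. Qed.

Lemma vector_compr v x : is_vector v -> v * x <= v.
Proof. by move=> vv; rewrite -{2}(vector_compT vv) comp_ler // lex1. Qed.

Lemma compT_vector x : is_vector (x * \top).
Proof.
rewrite /is_vector -compA; suff -> : \top * \top = \top :> S by [].
by apply: le_anti; rewrite lex1 -{1}[\top]comp1x comp_lel ?lex1.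
Qed.

Lemma comp_vector x v : is_vector v -> is_vector (x * v).
Proof. by move=> vv; rewrite /is_vector -compA vector_compT. Qed.

Lemma vector_compl v : is_vector v -> is_vector (~` v).
Proof.
move=> vv; apply/eqP/le_anti; rewrite -{3}[~` v]compx1 comp_ler ?lex1 // andbT.
rewrite -disj_leC; have := dedekindr (~` v) \top v.
by rewrite convT (vector_compT vv) meetCx comp0x lex0 => /eqP ->.
Qed.

Lemma vectorI v x y : is_vector v -> v `&` x * y = (v `&` x) * y.
Proof.
move=> vv; apply/eqP; rewrite eq_le lexI [X in _ && X]andbC.
rewrite comp_lel ?leIr //= (le_trans (comp_lel _ (leIl _ _))) ?vector_compr //.
rewrite andbT meetC; apply: le_trans (dedekindr _ _ _) _.
by rewrite comp_lel // meetC leI2 // vector_compr.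
Qed.

(** Restricting to the rows in [v] becomes multiplication by a subidentity, which is its own
    converse and so can be moved across products. *)
Lemma vectorI1 v x : is_vector v -> v `&` x = (v `&` 1) * x.
Proof. by move=> vv; rewrite -vectorI // comp1x. Qed.

Lemma vector_join v w : is_vector v -> is_vector w -> is_vector (v `|` w).
Proof. by move=> vv ww; rewrite /is_vector compUl !vector_compT. Qed.

Lemma vector_bot : is_vector (\bot : S).
Proof. by rewrite /is_vector comp0x. Qed.

(** * Star, reachability and components *)

Lemma star_ge1 x : 1 <= x^*.
Proof. by rewrite -star_unfoldl leUl. Qed.

Lemma star_stepl x : x * x^* <= x^*.
Proof. by rewrite -{2}star_unfoldl leUr. Qed.

Lemma star_stepr x : x^* * x <= x^*.
Proof. by rewrite -{2}star_unfoldr leUr. Qed.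

Lemma star_incr x : x <= x^*.
Proof. by apply: le_trans (star_stepl x); rewrite -{1}[x]compx1 comp_ler ?star_ge1. Qed.

Lemma star_trans x : x^* * x^* <= x^*.
Proof. by apply: star_inductl; rewrite leUx lexx star_stepl. Qed.

Lemma star_least x w : 1 <= w -> w * w <= w -> x <= w -> x^* <= w.
Proof.
move=> w1 ww xw; rewrite -[x^*]compx1; apply: star_inductl.
by rewrite leUx w1 (le_trans _ ww) // comp_lel.
Qed.

Lemma star_sub x y : x <= y^* -> x^* <= y^*.
Proof. by apply: star_least; rewrite ?star_ge1 ?star_trans. Qed.

Lemma conv_star x : (x^*)^T = (x^T)^*.
Proof.
have sub y : (y^T)^* <= (y^*)^T.
  apply: star_least; last by apply/conv_le/star_incr.
    by rewrite -conv1 conv_le ?star_ge1.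
  by rewrite -conv_comp conv_le ?star_trans.
apply/eqP; rewrite eq_le sub andbT conv_leE.
by have := sub x^T; rewrite convK.
Qed.

Lemma star_plus_le x y : x <= star_plus y -> star_plus x <= star_plus y.
Proof.
move=> xy; apply: le_trans (comp_le xy (star_sub (le_trans xy _))) _.
  exact: star_stepl.
by rewrite /star_plus -compA comp_ler ?star_trans.
Qed.

(** Star induction on the left factor: a backward step in front of a nonempty forward path cancels
    its first edge, since [p^T * p <= 1]. *)
Lemma univalent_confluent p : univalent p ->
  (p^T)^* * p^* <= p^* `|` (p^T)^*.
Proof.
move=> up; apply: star_inductl; rewrite leUx leUl /= compUr leUx.
rewrite (le_trans (star_stepl p^T)) ?leUr // andbT.
rewrite -{1}star_unfoldl compUr compx1 leUx (le_trans (star_incr _)) ?leUr //=.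
rewrite compA (le_trans (comp_lel _ up)) // comp1x ?leUl //.
Qed.

(** Two nodes are related when their forward paths meet; the middle factor [(p^T)^* * p^*] is
    resolved by confluence. *)
Lemma wcc_trans p : univalent p ->
  (p^* * (p^T)^*) * (p^* * (p^T)^*) <= p^* * (p^T)^*.
Proof.
move=> up; rewrite compA -(compA p^*).
apply: le_trans (comp_lel _ (comp_ler _ (univalent_confluent up))) _.
rewrite compUr compUl leUx comp_lel ?star_trans //=.
by rewrite -!compA comp_ler // star_trans.
Qed.

(** The right-hand side is reflexive, transitive and symmetric, so it absorbs the stars of [q] and
    [q^T]. Comparing components thus reduces to comparing single edges. *)
Lemma wcc_le p q : univalent p -> q <= p^* * (p^T)^* ->
  q^* * (q^T)^* <= p^* * (p^T)^*.
Proof.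
move=> up qp; have tr := wcc_trans up.
have w1 : 1 <= p^* * (p^T)^*.
  by rewrite -[X in X <= _](comp1x 1) comp_le ?star_ge1.
apply: le_trans (comp_le (star_least w1 tr qp) (star_least w1 tr _)) tr.
by rewrite conv_leE conv_comp !conv_star convK.
Qed.


(** * Array updates *)

Lemma vector_conv_comp v x y : is_vector v -> (v `&` x)^T * y = x^T * (v `&` y).
Proof.
move=> vv; rewrite vectorI1 // conv_comp (conv_subid (leIr _ _)) -compA.
by rewrite -vectorI1.
Qed.

Lemma mapping_comp f g : mapping f -> mapping g -> mapping (f * g).
Proof.
move=> /andP[uf tf] /andP[ug tg]; rewrite /mapping /univalent /total.
rewrite conv_comp !compA -(compA g^T) -(compA f g).
rewrite (le_trans (comp_lel _ (comp_ler _ uf))) ?compx1 //=.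
by apply: le_trans tf _; rewrite comp_lel // -{1}[f]compx1 comp_ler.
Qed.

Definition override v f g := (v `&` f) `|` (~` v `&` g).

Lemma override_in v f g z :
  is_vector v -> z <= v -> (override v f g)^T * z = f^T * z.
Proof.
move=> vv zv; rewrite convU compUl !vector_conv_comp ?vector_compl //.
rewrite (meet_r zv) (_ : ~` v `&` z = \bot) ?compx0 ?joinx0 //.
by apply/eqP; rewrite disj_leC leC.
Qed.

Lemma override_out v f g z :
  is_vector v -> z <= ~` v -> (override v f g)^T * z = g^T * z.
Proof.
move=> vv zv; rewrite convU compUl !vector_conv_comp ?vector_compl //.
rewrite (meet_r zv) (_ : v `&` z = \bot) ?compx0 ?join0x //.
by apply/eqP; rewrite disj_leC lexC.
Qed.

Lemma override_le v f g z : f <= z -> g <= z -> override v f g <= z.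
Proof. by move=> fz gz; rewrite leUx !leIxr. Qed.

Lemma override_mapping v f g :
  is_vector v -> mapping f -> mapping g -> mapping (override v f g).
Proof.
move=> vv /andP[uf tf] /andP[ug tg]; have nvv := vector_compl vv.
(* Totality is checked separately on the rows in [v] and on those outside; each half inherits it
   from [f] or [g]. *)
have rowtotal w h : is_vector w -> total h -> w `&` h <= override v f g ->
    w `&` 1 <= override v f g * (override v f g)^T.
  move=> ww th wh; apply: le_trans (comp_le wh (conv_le wh)).
  rewrite (vectorI1 h) // conv_comp (conv_subid (leIr _ _)).
  rewrite compA -(compA _ h) -{1}(subid_idem (leIr 1 w)) comp_lel //.
  by rewrite -{1}[w `&` 1]compx1 comp_ler.
apply/andP; split; last first.
  rewrite /total -[leLHS]meet1x -(joinxC v) meetUl leUx.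
  by rewrite (rowtotal v f) ?leUl // (rowtotal (~` v) g) ?leUr.
rewrite /univalent {2}/override compUr leUx.
rewrite override_in ?leIl // override_out ?leIl //.
by rewrite (le_trans (comp_ler _ (leIr _ _)) uf) (le_trans (comp_ler _ (leIr _ _)) ug).
Qed.

(** * Points as nodes, with [a * b^T] as the single edge from [a] to [b] *)

Lemma point_injective a : point a -> a * a^T <= 1.
Proof. by case/and3P. Qed.

Lemma point_surjective a : point a -> 1 <= a^T * a.
Proof. by case/and3P. Qed.

Lemma point_vector a : point a -> is_vector a.
Proof. by case/and3P. Qed.

Lemma point_via a x y : point a -> x * y <= (x * a^T) * (a * y).
Proof.
move=> pa; rewrite compA -(compA x) comp_lel // -{1}[x]compx1 comp_ler //.
exact: point_surjective.
Qed.

Lemma point_conv_comp f a : mapping f -> point a -> point (f^T * a).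
Proof.
move=> /andP[uf tf] pa; apply/and3P; split.
- rewrite /injective_elt conv_comp convK compA -(compA f^T).
  rewrite (le_trans (comp_lel _ (comp_ler _ (point_injective pa)))) //.
  by rewrite compx1.
- rewrite /surjective_elt conv_comp convK compA -(compA a^T).
  apply: le_trans (point_surjective pa) _.
  by rewrite comp_lel // -{1}[a^T]compx1 comp_ler.
- exact/comp_vector/point_vector.
Qed.

(** The chain is [b <= b * a^T * a <= b * b^T * a <= a]. *)
Lemma point_le_eq a b : point a -> point b -> a <= b -> a = b.
Proof.
move=> pa pb ab; apply: le_anti; rewrite ab /=.
rewrite -[leLHS]compx1 (le_trans (comp_ler _ (point_surjective pa))) // compA.
rewrite (le_trans (comp_lel _ (comp_ler _ (conv_le ab)))) //.
by rewrite (le_trans (comp_lel _ (point_injective pb))) // comp1x.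
Qed.

(** The row of [f] at a node is the edge to its image; the Dedekind law gives one inclusion,
    injectivity of [a] the other. *)
Lemma point_row a f : point a -> a `&` f = a * (f^T * a)^T.
Proof.
move=> pa; have va := point_vector pa; rewrite conv_comp convK.
apply: le_anti; rewrite lexI vector_compr // compA /=.
rewrite (le_trans (comp_lel _ (point_injective pa))) ?comp1x // andbT.
rewrite -{1}(vector_compT va) (le_trans (dedekind _ _ _)) // -compA.
by rewrite comp_ler ?leIr.
Qed.

Lemma vector_meet_conv v w : is_vector v -> is_vector w -> v `&` w^T = v * w^T.
Proof.
move=> vv vw; rewrite -{1}(vector_compT vw) conv_comp convT vectorI //.
by rewrite meetx1.
Qed.

Lemma point_update a f : point a -> a `&` (f^T * a)^T = a `&` f.
Proof.
move=> pa; have va := point_vector pa.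
by rewrite [RHS]point_row // vector_meet_conv //; apply: comp_vector.
Qed.

(** The join is closed under [g]: each member moves to the next one, and the last is stationary. *)
Lemma star_orbit g (b : nat -> S) n :
    (forall i, (i <= n)%N -> g * b i = b i.+1) -> b n.+1 = b n ->
  g^* * b 0%N = \join_(i < n.+1) b i.
Proof.
move=> gb bn; apply: le_anti; apply/andP; split.
  apply: star_inductl; rewrite leUx (joins_sup (j := ord0)) //=.
  rewrite (big_morph (Defs.comp g) (compUr g) (compx0 g)).
  apply/joinsP => i _; rewrite gb -1?ltnS //.
  case: (ltngtP i n) (ltn_ord i) => [lt_in _|//|-> _]; last 1 first.
  - by rewrite bn (joins_sup (j := ord_max)).
  - by rewrite (joins_sup (j := Ordinal (lt_in : i.+1 < n.+1)%N)).
  - by rewrite ltnNge => /negP.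
apply/joinsP => -[i /= ltin] _; elim: i ltin => [|i IH] ltin.
  by rewrite -{1}[b 0%N]comp1x comp_lel // star_ge1.
rewrite -gb; last exact: ltnW.
by rewrite (le_trans (comp_ler _ (IH (ltnW ltin)))) // compA comp_lel ?star_stepl.
Qed.

End RelationAlgebra.

(** * Forests, roots and cycles *)

Section Forest.
Context {d : Order.disp_t} {S : kraType d}.
Implicit Types a b p v x : S.

Lemma le_loopfree p : p <= 1 `|` (p `&` ~` 1).
Proof. exact: leIC_leU. Qed.

Lemma star_loopfree p : p^* <= (p `&` ~` 1)^*.
Proof.
apply/star_sub/(le_trans (le_loopfree p)).
by rewrite leUx star_ge1 star_incr.
Qed.

Lemma star_plus_ge p : p <= star_plus p.
Proof. by rewrite -{1}[p]compx1 comp_ler // star_ge1. Qed.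

Lemma star_plus_ge2 p : p * p <= star_plus p.
Proof. by rewrite comp_ler // star_incr. Qed.

Lemma loopfree_comp p : p * p <= p `|` star_plus (p `&` ~` 1).
Proof.
set q := p `&` ~` 1.
apply: le_trans (comp_lel _ (le_loopfree p)) _; rewrite compUl comp1x leUx leUl /=.
apply: le_trans (comp_ler _ (le_loopfree p)) _; rewrite compUr compx1 leUx.
by rewrite !lexU2 ?leIl ?star_plus_ge2 ?orbT.
Qed.

(** By [loopfree_comp] a double step lies in [p] or is a nonempty loop-free path; acyclicity keeps
    the latter off the diagonal. *)
Lemma forest_fixed_comp p : forest p -> (p * p) `&` 1 = p `&` 1.
Proof.
case/andP=> _ ac; apply: le_anti; rewrite !lexI !leIr !andbT; apply/andP; split.
  rewrite -[X in _ `&` X]complK -diffE leBLR joinC.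
  by apply: le_trans (loopfree_comp p) _; apply: leU2.
by rewrite -{1}(subid_idem (leIr 1 p)) comp_le ?leIl.
Qed.

(** Every non-loop edge of [q] is a nonempty path in the loop-free part of [p], so a cycle in [q]
    would give one in [p]. *)
Lemma forest_shortcut p q :
  forest p -> mapping q -> q <= p `|` p * p -> forest q.
Proof.
case/andP=> _ ac mq qp; rewrite /forest mq /=.
apply: le_trans (star_plus_le _) ac.
rewrite -diffE leBLR; apply: le_trans qp _; rewrite leUx.
have ppl : p <= 1 `|` star_plus (p `&` ~` 1).
  apply: le_trans (le_loopfree p) _; apply: leU2 => //; exact: star_plus_ge.
by rewrite ppl (le_trans (loopfree_comp p)) // leUx ppl leUr.
Qed.

Lemma iter_conv_comp p a m :
  point a -> a * (iter m (fun z => p^T * z) a)^T <= p^*.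
Proof.
move=> pa; elim: m => [|m IH] /=.
  by rewrite (le_trans (point_injective pa)) // star_ge1.
by rewrite conv_comp convK compA (le_trans (comp_lel _ IH)) ?star_stepr.
Qed.

Lemma point_root p a : point a -> a <= (p `&` 1) * \top -> a <= p^T * a.
Proof.
move=> pa; have e1 := leIr 1 p => /meet_idPl aR; rewrite -{1}aR meetC.
apply: le_trans (dedekind _ _ _) _; rewrite meet1x conv_subid // compA subid_idem //.
by rewrite -(conv_subid e1) comp_lel // conv_le ?leIl.
Qed.

(** The loop [a * a^T] lies below [1] by injectivity and below [p] because [a] is its own parent. *)
Lemma root_point p a : point a -> p^T * a = a -> a <= (p `&` 1) * \top.
Proof.
move=> pa pra; apply: le_trans (comp_conv_comp a) _; apply: comp_le => //.
rewrite lexI (point_injective pa) andbT -{2}pra conv_comp convK compA.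
by rewrite (le_trans (comp_lel _ (point_injective pa))) // comp1x.
Qed.

Hypothesis tarski : tarski_rule S.

(** If the meet [w] of [a] and [v] is nonzero, the Tarski rule gives [w^T * w = \top], whence
    [a = a * w^T * w <= a * a^T * w <= w]. *)
Lemma point_atom a v : point a -> is_vector v -> a <= v \/ a <= ~` v.
Proof.
move=> pa vv; have va := point_vector pa.
have [av0|/eqP av0] := eqVneq (a `&` v) \bot.
  by right; rewrite -disj_leC av0.
left; set w := a `&` v in av0 *.
have ww : is_vector w by rewrite /is_vector -vectorI // vector_compT.
have w1 : w^T * w = \top.
  have wTw0 : w^T * w != \bot.
    apply/eqP => w0; apply: av0; apply: le_anti; rewrite le0x andbT.
    by apply: le_trans (comp_conv_comp w) _; rewrite -compA w0 compx0.
  rewrite -(tarski wTw0) -!compA (vector_compT ww) compA; congr (_ * _).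
  by rewrite -{1}(vector_compT ww) conv_comp convT.
apply: le_trans (_ : a <= w) (leIr v a); rewrite -{1}(vector_compT va) -w1 compA.
rewrite (le_trans (comp_lel _ (comp_ler _ (conv_le (leIl _ _ : w <= a))))) //.
by rewrite (le_trans (comp_lel _ (point_injective pa))) ?comp1x.
Qed.

Lemma point_neq a b : point a -> point b -> a != b -> a <= ~` b.
Proof.
move=> pa pb; have [/(point_le_eq pa pb) ->|//] := point_atom pa (point_vector pb).
by rewrite eqxx.
Qed.

(** If the parent [b] differs from [a], then [a * b^T] is a loop-free edge and [b * a^T] a loop-free
    path back. So [a * a^T] lies below both [1] and its complement, which forces [a = \bot], and
    then [b = a] after all. *)
Lemma forest_cycle p a m : forest p -> point a ->
  iter m.+1 (fun z => p^T * z) a = a -> p^T * a = a.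
Proof.
move=> /andP[mp ac] pa; rewrite iterSr; set b := p^T * a => cyc.
have pb : point b by apply: point_conv_comp.
have [//|/(point_neq pb pa) ba] := eqVneq b a.
have abq : a * b^T <= p `&` ~` 1.
  rewrite lexI; apply/andP; split; first by rewrite -point_row // leIr.
  rewrite -disj_leC; apply/eqP/le_anti; rewrite le0x andbT.
  apply: le_trans (dedekind _ _ _) _; rewrite compx1 -convI.
  by move: ba; rewrite -disj_leC => /eqP ->; rewrite conv0 compx0.
have baq : b * a^T <= (p `&` ~` 1)^*.
  by rewrite -{1}cyc (le_trans (iter_conv_comp _ _ pb)) // star_loopfree.
have a0 : a = \bot.
  apply: le_anti; rewrite le0x andbT; apply: le_trans (comp_conv_comp a) _.
  rewrite (_ : a * a^T = \bot) ?comp0x //; apply: le_anti; rewrite le0x andbT.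
  rewrite -(meetxC 1) lexI (point_injective pa) /=.
  apply: le_trans (point_via _ _ pb) (le_trans (comp_le abq baq) ac).
by rewrite /b a0 compx0.
Qed.

End Forest.

(** * Determinism of the semantics *)

Section Execution.
Variable State : Type.
Implicit Types (c : cmd State) (s t u : State).

Lemma exec_inv c s t : exec c s t ->
  match c with
  | Assign f => t = f s
  | Seq c1 c2 => exists2 u, exec c1 s u & exec c2 u t
  | While b c1 =>
    if b s then exists2 u, exec c1 s u & exec (While b c1) u t else t = s
  end.
Proof.
case=> // {c s t} [c1 c2 s t u|b c s ->|b c s t u ->] //; by exists t.
Qed.

Lemma exec_deterministic c s t u : exec c s t -> exec c s u -> t = u.
Proof.
move=> st; elim: st u => {c s t}.
- by move=> f s u /exec_inv.
- by move=> c1 c2 s t w _ IH1 _ IH2 u /exec_inv[v /IH1 <- /IH2].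
- by move=> b c s bs u /exec_inv; rewrite bs.
- by move=> b c s t w bs _ IH1 _ IH2 u /exec_inv; rewrite bs => -[v /IH1 <- /IH2].
Qed.

End Execution.

(** * The sequence of ancestors *)

Section PathHalvingProof.
Context {d : Order.disp_t} {S : finKraType d}.
Hypothesis tarski : tarski_rule S.
Variables p0 x : S.
Hypotheses (p0_forest : forest p0) (x_point : point x).

Let mp0 : mapping p0. Proof. by case/andP: p0_forest. Qed.

Definition ancestor k := iter k (fun z => p0^T * z) x.
Local Notation a := ancestor.

Lemma ancestor_point k : point (a k).
Proof. by elim: k => //= k; apply: point_conv_comp. Qed.

Lemma ancestor_repeat i j : (i < j)%N -> a i = a j -> a i.+1 = a i.
Proof.
move=> ij eij; apply: (@forest_cycle _ _ tarski _ _ (j - i.+1) p0_forest).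
  exact: ancestor_point.
by rewrite -iterD addSnnS subnK // -[RHS]/(a i) eij.
Qed.

Lemma ancestor_root i j : (i <= j)%N -> a i.+1 = a i -> a j = a i.
Proof. by move=> /subnK <- ai; elim: (j - i)%N => //= k ->. Qed.

Lemma halving_ends : exists k, a k.*2.+1 == a k.*2.
Proof.
(* Pigeonhole: one more ancestor than [S] has elements. The repeated index [i] is a root, and
   [i <= i.*2] carries this to the even index. *)
have /injectivePn [i [j ij aij]] : ~~ injectiveb (fun i : 'I_#|S|.+1 => a i).
  by apply/negP => /injectiveP /leq_card; rewrite card_ord ltnn.
wlog lt_ij : i j ij aij / (i < j)%N.
  by move: (ij); rewrite neq_ltn => /orP[] lt_ij H; apply: (H _ _ _ _ lt_ij);
    rewrite // eq_sym.
have ai := ancestor_repeat lt_ij aij; exists i.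
by rewrite !(ancestor_root _ ai) // -addnn ?leqW ?leq_addr.
Qed.

Variable n : nat.
Hypothesis end_n : a n.*2.+1 = a n.*2.
Hypothesis n_min : forall k, a k.*2.+1 = a k.*2 -> (n <= k)%N.

Lemma ancestor_neq i j : (i < n)%N -> (i.*2 < j)%N -> a i.*2 != a j.
Proof.
move=> lt_in ij; apply/eqP => /(ancestor_repeat ij) /n_min.
by rewrite leqNgt lt_in.
Qed.

(** The nodes redirected by the first [k] iterations. *)
Definition visited k := \join_(i < k) a i.*2.
Definition parent k := override (visited k) (p0 * p0) p0.

Lemma visited_vector k : is_vector (visited k).
Proof.
rewrite /visited; elim: k => [|k IH]; first by rewrite big_ord0 vector_bot.
by rewrite big_ord_recr /= vector_join // point_vector // ancestor_point.
Qed.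

Lemma visitedS k : visited k.+1 = visited k `|` a k.*2.
Proof. exact: big_ord_recr. Qed.

Lemma parent_mapping k : mapping (parent k).
Proof. by apply: override_mapping; rewrite ?visited_vector ?mapping_comp. Qed.

(** A recurrence of [a i.*2] with [i < n] would make it a root, against the minimality of [n];
    distinct points are disjoint. *)
Lemma unvisited k j : (k <= n)%N -> (k.*2 <= j)%N -> a j <= ~` visited k.
Proof.
move=> le_kn le_kj; rewrite lexC; apply/joinsP => i _.
apply: (point_neq tarski); rewrite ?ancestor_point // ancestor_neq //.
  exact: leq_trans (ltn_ord i) le_kn.
by rewrite (leq_trans _ le_kj) // ltn_double.
Qed.

Lemma parent_unvisited k j :
  (k <= n)%N -> (k.*2 <= j)%N -> (parent k)^T * a j = a j.+1.
Proof. by move=> ? ?; rewrite override_out ?visited_vector // unvisited. Qed.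

Lemma parent_visited k i : (i < k)%N -> (parent k)^T * a i.*2 = a i.+1.*2.
Proof.
move=> ik; rewrite override_in ?visited_vector ?conv_comp -?compA //.
exact: (joins_sup (j := Ordinal ik)).
Qed.

Lemma parent_step k : (k < n)%N ->
  (a k.*2 `&` ((parent k)^T * (parent k)^T * a k.*2)^T)
    `|` (~` a k.*2 `&` parent k) = parent k.+1.
Proof.
move=> lt_kn; have le_kn := ltnW lt_kn.
rewrite -compA parent_unvisited // parent_unvisited ?leqnSn //.
have -> : a k.*2.+2 = (p0 * p0)^T * a k.*2 by rewrite conv_comp -compA.
rewrite point_update ?ancestor_point // /parent visitedS /override.
rewrite meetUr !meetA complU (meetC (~` visited k)) joinA; congr (_ `|` _).
(* The new row [a k.*2] is disjoint from those redirected before, so they are kept. *)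
by rewrite meetUl joinC (meet_r (_ : visited k <= _)) // lexC unvisited.
Qed.

Lemma path_halving_exec y0 :
  exec (path_halving x) (Store p0 y0) (Store (parent n) (a n.*2)).
Proof.
have p00 : p0 = parent 0.
  by rewrite /parent /visited big_ord0 /override meet0x join0x compl0 meet1x.
apply: ExecSeq; first exact: ExecAssign.
rewrite [X in Store X _]p00.
(* Here [k] counts the remaining iterations, so the induction starts from the exit of the loop. *)
have loop k : (k <= n)%N -> exec (while_do (fun p y => y != p^T * y)
    (Seq (assign_p (fun p y => (y `&` (p^T * p^T * y)^T) `|` (~` y `&` p)))
         (assign_y (fun p y => p^T * y))))
    (Store (parent (n - k)) (a (n - k).*2)) (Store (parent n) (a n.*2)).
  elim: k => [|k IH] le_kn.
    rewrite subn0; apply: ExecWhileFalse => /=.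
    by rewrite parent_unvisited // end_n eqxx.
  have lt : (n - k.+1 < n)%N by rewrite ltn_subrL (leq_trans _ le_kn).
  apply: ExecWhileTrue (IH (ltnW le_kn)).
    by rewrite /= parent_unvisited ?ancestor_neq ?leq_subr.
  apply: ExecSeq; first exact: ExecAssign.
  rewrite /= parent_step // -subSn // subSS.
  (* The second assignment reads the updated [p], where the current node is already redirected: one
     step advances two ancestors. *)
  have -> : a (n - k).*2 = (parent (n - k))^T * a (n - k.+1).*2.
    by rewrite -subSS subSn // parent_visited.
  exact: ExecAssign.
by have := loop n (leqnn n); rewrite subnn.
Qed.

(** * Properties of the final state *)

Lemma evens_end : a n.+1.*2 = a n.*2.
Proof. by apply: ancestor_root end_n; rewrite leq_double. Qed.

Lemma star_grandparent : ((p0 * p0)^T)^* * x = visited n.+1.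
Proof.
apply: (star_orbit (b := fun i => a i.*2)) => [i _|]; last exact: evens_end.
by rewrite conv_comp -compA.
Qed.

Let p := parent n.
Let r := a n.*2.

(** The loop leaves the row of [r] alone, but [p0 * p0] and [p0] agree on it since [r] is a root. *)
Lemma final_parentE : p = override (visited n.+1) (p0 * p0) p0.
Proof.
have pr : point r by apply: ancestor_point.
have rootE : r `&` (p0 * p0) = r `&` p0.
  rewrite !point_row // (conv_comp p0 p0) -compA.
  by have pr0 : p0^T * r = r := end_n; rewrite !pr0.
rewrite /p /parent visitedS /override meetUl rootE -joinA; congr (_ `|` _).
rewrite complU -meetA -/r -{1}(meet1x p0) -(joinxC r) meetUl meetUr; congr (_ `|` _).
by rewrite meetA (meet_r (unvisited _ _)).
Qed.

Lemma final_parent_le : p <= p0 `|` p0 * p0.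
Proof. by rewrite override_le ?leUl ?leUr. Qed.

Lemma final_forest : forest p.
Proof. exact: forest_shortcut (parent_mapping n) final_parent_le. Qed.

Lemma final_fixed : p `&` 1 = p0 `&` 1.
Proof.
rewrite /p /parent /override meetUl -!meetA (forest_fixed_comp p0_forest).
by rewrite -meetUl joinxC meet1x.
Qed.

Lemma final_star : (p^T)^* * x = visited n.+1.
Proof.
apply: (star_orbit (b := fun i => a i.*2)) => [i|]; last exact: evens_end.
rewrite leq_eqVlt => /predU1P[->|]; last exact: parent_visited.
by rewrite evens_end parent_unvisited.
Qed.

Lemma final_root : r = ((p^T)^* * x) `&` ((p `&` 1) * \top).
Proof.
have pa := ancestor_point; rewrite final_fixed final_star.
apply: le_anti; apply/andP; split.
  rewrite lexI; apply/andP; split; first exact: (joins_sup (j := ord_max)).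
  by apply: root_point; [apply: pa | apply: end_n].
rewrite -[X in _ `&` X]complK -diffE leBLR; apply/joinsP => i _.
set R := _ * \top.
(* An even ancestor that is a root equals all later ancestors, in particular [r]. *)
have [aR|aR] := point_atom tarski (pa i.*2) (compT_vector _ : is_vector R).
  have /(point_le_eq (pa _) (pa i.*2.+1)) ai := point_root (pa _) aR.
  rewrite -(ancestor_root (j := n.*2) _ (esym ai)) ?leUr //.
  by rewrite leq_double -ltnS.
by rewrite (le_trans aR) ?leUl.
Qed.

Lemma edge_star i j :
  (p^T) * a i = a j -> a j * r^T <= p^* -> a i * r^T <= p^*.
Proof.
move=> ij jr; apply: le_trans (point_via _ _ (ancestor_point j)) _.
rewrite -ij -point_row ?ancestor_point // ij.
by apply: le_trans (comp_le (leIr _ _) jr) (star_stepl p).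
Qed.

Lemma even_to_root i : (i <= n)%N -> a i.*2 * r^T <= p^*.
Proof.
move=> /subKn <-; elim: (n - i)%N => [|k IH].
  by rewrite subn0 (le_trans (point_injective _)) ?star_ge1 ?ancestor_point.
case: (leqP n k) => [le_nk|lt_kn].
  (* Truncated subtraction: both indices are [0]. *)
  by rewrite subnS (eqP (le_nk : n - k == 0)%N) in IH *.
apply: edge_star IH; have -> : (n - k = (n - k.+1).+1)%N by rewrite -subSn ?subSS.
by apply: parent_visited; rewrite ltn_subrL (leq_ltn_trans _ lt_kn).
Qed.

(** For [i < n], either the node equals a redirected even ancestor, or its row is still that of [p0]
    and leads to [a i.+1.*2]. *)
Lemma odd_to_root i : (i <= n)%N -> a i.*2.+1 * r^T <= p^*.
Proof.
rewrite leq_eqVlt => /predU1P[->|lt_in]; first by rewrite end_n even_to_root.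
have [[j aj]|aN] :
    (exists j : 'I_n, a i.*2.+1 = a j.*2) \/ a i.*2.+1 <= ~` visited n.
- have [/existsP[j /eqP]|] :=
    boolP [exists j : 'I_n, a i.*2.+1 == a j.*2]; first by left; exists j.
  rewrite negb_exists => /forallP neq; right; rewrite lexC.
  apply/joinsP => j _; apply: (point_neq tarski); rewrite ?ancestor_point //.
  by rewrite eq_sym.
- by rewrite aj even_to_root // ltnW.
apply: (edge_star (j := i.+1.*2)); last exact: even_to_root.
by rewrite override_out ?visited_vector.
Qed.

Lemma final_wcc : p^* * (p^T)^* = p0^* * (p0^T)^*.
Proof.
have uni q : forest q -> univalent q by case/andP => /andP[].
apply: le_anti; rewrite !wcc_le ?uni ?final_forest //.
  (* An edge of [p0] leaving a visited [a i.*2] ends in [a i.*2.+1], and both ends reach [r] in [p];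
     all other edges of [p0] are edges of [p]. *)
  rewrite -[p0]meet1x -(joinxC (visited n.+1)) meetUl leUx; apply/andP; split.
    rewrite -[X in _ `&` X]complK -diffE leBLR.
    apply/joinsP => i _; apply: leIC_leU; rewrite complK point_row ?ancestor_point //.
    apply: le_trans (point_via _ _ (ancestor_point n.*2)) _.
    rewrite comp_le ?even_to_root -1?ltnS // -conv_star -conv_leE conv_comp convK.
    by rewrite odd_to_root -1?ltnS.
  have pp : ~` visited n.+1 `&` p0 <= p by rewrite final_parentE leUr.
  apply: le_trans pp _; rewrite -[p in leLHS]compx1.
  by rewrite comp_le ?star_incr ?star_ge1.
apply: le_trans final_parent_le _; rewrite -[leLHS]compx1 comp_le ?star_ge1 //.
by rewrite leUx star_incr (le_trans (comp_ler _ (star_incr _))) ?star_stepl.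
Qed.

End PathHalvingProof.

Theorem mainTheorem19 (d : Order.disp_t) (S : finKraType d)
    (tarski : tarski_rule S) (p0 x y0 : S)
    (p0_forest : forest p0) (x_point : point x) :
  terminates (path_halving x) (Store p0 y0) /\
  forall p y : S, exec (path_halving x) (Store p0 y0) (Store p y) ->
    let v := ((p0 * p0)^T)^* * x in
    forest p /\
    point y /\
    y = ((p^T)^* * x) `&` ((p `&` 1) * \top) /\
    p^* * (p^T)^* = p0^* * (p0^T)^* /\
    p `&` 1 = p0 `&` 1 /\
    p = (v `&` (p0 * p0)) `|` (~` v `&` p0).
Proof.
have [n /eqP end_n min_n] := ex_minnP (halving_ends tarski p0_forest x_point).
have n_min k : ancestor p0 x k.*2.+1 = ancestor p0 x k.*2 -> (n <= k)%N.
  by move=> /eqP /min_n.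
have run := path_halving_exec tarski p0_forest x_point end_n n_min y0.
split=> [|p y /(exec_deterministic run) [<- <-]]; first by eexists; apply: run.
split; first exact: final_forest.
split; first exact: ancestor_point.
split; first exact: final_root.
split; first exact: final_wcc.
split; first exact: final_fixed.
by rewrite (star_grandparent end_n); apply: final_parentE.
Qed.
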